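(* Let $G\in\mathbb{R}^{m\times n}$ be a matrix with no zero row such that $A := G^TG\in\mathbb{R}^{n\times n}$ is symmetric positive definite. Let $\{\omega_i\}_{i=1}^{n_c}$ be a partition of $\{1,\dots,n\}$ into nonoverlapping aggregates, and for each $i$ let $\Gamma_i$, $\Omega_i=\omega_i\cup\Gamma_i$, $\Delta_i$, $\mathcal{R}_i$ and $\mathrm{nz}_i$ be as defined in the context. Assume that for every $i$ the submatrix of $G$ with rows $\mathrm{nz}_i$ and columns $\Delta_i$ is zero. For $j\in\{1,\dots,m\}$ define the multiplicity $M(j) := |\{k\in\{1,\dots,n_c\} : j\in \mathrm{nz}_k\}|$, and let $W := \mathrm{diag}(1/M(j))\in\mathbb{R}^{m\times m}$. For each $i\in\{1,\dots,n_c\}$ define the weighted aggregate matrix $$\widetilde{A}_i := \begin{pmatrix} G_{\mathrm{nz}_i,\omega_i}^T W(\mathrm{nz}_i,\mathrm{nz}_i) G_{\mathrm{nz}_i,\omega_i} & G_{\mathrm{nz}_i,\omega_i}^T W(\mathrm{nz}_i,\mathrm{nz}_i) G_{\mathrm{nz}_i,\Gamma_i}\\ G_{\mathrm{nz}_i,\Gamma_i}^T W(\mathrm{nz}_i,\mathrm{nz}_i) G_{\mathrm{nz}_i,\omega_i} & G_{\mathrm{nz}_i,\Gamma_i}^T W(\mathrm{nz}_i,\mathrm{nz}_i) G_{\mathrm{nz}_i,\Gamma_i}\end{pmatrix}\in\mathbb{R}^{|\Omega_i|\times|\Omega_i|}.$$ Then $\widetilde{A}_i$ is symmetric positive semidefinite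 for every $i\in\{1,\dots,n_c\}$, and $$A = \sum_{i=1}^{n_c}\mathcal{R}_i^T\,\widetilde{A}_i\,\mathcal{R}_i .$$
   Context: The nodes of the sparsity graph of $A=G^TG$ are the indices $\{1,\dots,n\}$, with distinct nodes $k,l$ adjacent when $A_{kl}\neq 0$; these nodes are identified with the columns of $G$. The nonoverlapping aggregates $\omega_1,\dots,\omega_{n_c}$ are pairwise disjoint subsets whose union is $\{1,\dots,n\}$. For each $i$: - $\Gamma_i$ is the set of nodes not in $\omega_i$ that are adjacent, in the sparsity graph of $A$, to some node in $\omega_i$. - $\Omega_i := \omega_i\cup\Gamma_i$ is the $i$th overlapping aggregate, with its indices ordered so that those of $\omega_i$ come first, followed by those of $\Gamma_i$. - $\Delta_i := \{1,\dots,n\}\setminus\Omega_i$. - $\mathcal{R}_i := I(\Omega_i,:)\in\mathbb{R}^{|\Omega_i|\times n}$ consists of the rows of the $n\times n$ identity matrix indexed by $\Omega_i$, with the rows indexed by $\omega_i$ first, followed by the rows indexed by $\Gamma_i$. - $\mathrm{nz}_i\subseteq\{1,\dots,m\}$ is the set of indices of rows of $G$ having at least one nonzero entry in a column belonging to $\omega_i$. For index sets $S\subseteq\{1,\dots,m\}$ and $T\subseteq\{1,\dots,n\}$, $G_{S,T}$ denotes the submatrix of $G$ with rows $S$ and columns $T$. Likewise, $W(S,S)$ is the principal submatrix of $W$ with rows and columns $S$. *)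

(* Defs.v *)
From mathcomp Require Import all_boot all_order all_algebra.
From mathcomp Require Import reals.

Set Implicit Arguments.
Unset Strict Implicit.
Unset Printing Implicit Defensive.

Import Order.TTheory GRing.Theory Num.Theory.
Local Open Scope ring_scope.

Definition spd (R : realType) (n : nat) (A : 'M[R]_n) : Prop :=
  A \is symmetricmx /\
  forall x : 'cV[R]_n, x != 0 -> 0 < (x^T *m A *m x) 0 0.

Definition spsd (R : realType) (n : nat) (A : 'M[R]_n) : Prop :=
  A \is symmetricmx /\
  forall x : 'cV[R]_n, 0 <= (x^T *m A *m x) 0 0.

(* [B(S, T)]: rows [S] and columns [T], each in increasing index order. *)
Definition setsub (R : realType) (m n : nat) (B : 'M[R]_(m, n))
    (S : {set 'I_m}) (T : {set 'I_n}) : 'M[R]_(#|S|, #|T|) :=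
  mxsub (fun a : 'I_#|S| => enum_val a) (fun b : 'I_#|T| => enum_val b) B.

Definition sparsity_graph (R : realType) (n : nat) (A : 'M[R]_n) : rel 'I_n :=
  fun k l => (k != l) && (A k l != 0).

(* Empty aggregates are allowed. *)
Definition nonoverlapping_aggregates (n nc : nat)
    (omega : 'I_nc -> {set 'I_n}) : Prop :=
  (forall k l : 'I_nc, k != l -> [disjoint omega k & omega l]) /\
  \bigcup_(k < nc) omega k = [set: 'I_n].

(* In what follows [om] is a single aggregate [omega i]. *)
Definition Gamma (R : realType) (m n : nat) (G : 'M[R]_(m, n))
    (om : {set 'I_n}) : {set 'I_n} :=
  [set k | (k \notin om) &&
           [exists l in om, sparsity_graph (G^T *m G) k l]].

Definition Omega (R : realType) (m n : nat) (G : 'M[R]_(m, n))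
    (om : {set 'I_n}) : {set 'I_n} :=
  om :|: Gamma G om.

Definition Delta (R : realType) (m n : nat) (G : 'M[R]_(m, n))
    (om : {set 'I_n}) : {set 'I_n} :=
  ~: Omega G om.

Definition nz (R : realType) (m n : nat) (G : 'M[R]_(m, n))
    (om : {set 'I_n}) : {set 'I_m} :=
  [set j | [exists k in om, G j k != 0]].

(* The ordering of [Omega] (first [om], then [Gamma]) is encoded by indexing
   it with ['I_(#|om| + #|Gamma G om|)], the block index type of [col_mx] and
   [block_mx]; the sum is the cardinal of [Omega]: *)
Lemma card_Omega (R : realType) (m n : nat) (G : 'M[R]_(m, n))
    (om : {set 'I_n}) : #|Omega G om| = (#|om| + #|Gamma G om|)%N.
Proof.
rewrite /Omega cardsU; suff -> : om :&: Gamma G om = set0 by rewrite cards0 subn0.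
by apply/setP => k; rewrite !inE; case: (k \in om).
Qed.

(* [I(Omega, :)], as the blocks [I(om, :)] and [I(Gamma, :)]. *)
Definition restriction (R : realType) (m n : nat) (G : 'M[R]_(m, n))
    (om : {set 'I_n}) : 'M[R]_(#|om| + #|Gamma G om|, n) :=
  col_mx (rowsub (fun a : 'I_#|om| => enum_val a) 1%:M)
         (rowsub (fun a : 'I_#|Gamma G om| => enum_val a) 1%:M).

Definition multiplicity (R : realType) (m n nc : nat) (G : 'M[R]_(m, n))
    (omega : 'I_nc -> {set 'I_n}) (j : 'I_m) : nat :=
  #|[set k : 'I_nc | j \in nz G (omega k)]|.

(* Every multiplicity is positive once [G] has no zero row and the aggregates
   cover all columns, so the convention [0^-1 = 0] plays no role then. *)
Definition weight (R : realType) (m n nc : nat) (G : 'M[R]_(m, n))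
    (omega : 'I_nc -> {set 'I_n}) : 'M[R]_m :=
  diag_mx (\row_(j < m) (multiplicity G omega j)%:R^-1).

Definition weighted_aggregate (R : realType) (m n nc : nat) (G : 'M[R]_(m, n))
    (omega : 'I_nc -> {set 'I_n}) (i : 'I_nc) :
    'M[R]_(#|omega i| + #|Gamma G (omega i)|) :=
  let S := nz G (omega i) in
  let Wi := setsub (weight G omega) S S in
  let Go := setsub G S (omega i) in
  let Gg := setsub G S (Gamma G (omega i)) in
  block_mx (Go^T *m Wi *m Go) (Go^T *m Wi *m Gg)
           (Gg^T *m Wi *m Go) (Gg^T *m Wi *m Gg).

(* Main.v *)
(* Writing [sel S] for the rows of the identity indexed by [S], the weighted
   aggregate factors as [B^T *m W(nz_i, nz_i) *m B] with [B] the matrix [G]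
   restricted to the rows [nz_i] and the columns [omega_i], [Gamma_i].  This
   form is positive semidefinite since the weights are nonnegative.  As the
   block [G(nz_i, Delta_i)] vanishes, [B *m R_i = sel nz_i *m G], so each term of
   the sum is [G^T *m D_i *m G] with [D_i] the diagonal of the weights of the
   rows in [nz_i]; a row [j] occurs in exactly [M(j) > 0] of the [D_i], which
   therefore add up to the identity. *)
Require Import Defs.
From mathcomp Require Import all_boot all_order all_algebra.
From mathcomp Require Import reals.

Set Implicit Arguments.
Unset Strict Implicit.
Unset Printing Implicit Defensive.

Import Order.TTheory GRing.Theory Num.Theory.
Local Open Scope ring_scope.

Definition sel (R : realType) (n : nat) (S : {set 'I_n}) : 'M[R]_(#|S|, n) :=
  rowsub (fun a : 'I_#|S| => enum_val a) 1%:M.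

Definition diag_ind (R : realType) (n : nat) (S : {set 'I_n}) : 'M[R]_n :=
  diag_mx (\row_(k < n) (k \in S)%:R).

(** Turns submatrix extraction into matrix products, so that later identities reduce to
    associativity. *)
Lemma setsubE (R : realType) (m n : nat) (B : 'M[R]_(m, n))
    (S : {set 'I_m}) (T : {set 'I_n}) :
  setsub B S T = sel R S *m B *m (sel R T)^T.
Proof.
rewrite /sel trmx_mxsub trmx1 mul_rowsub_mx mul1mx mulmx_colsub mulmx1.
by rewrite -mxsubcr.
Qed.

Lemma tr_sel_mul (R : realType) (n : nat) (S : {set 'I_n}) :
  (sel R S)^T *m sel R S = diag_ind R S.
Proof.
apply/matrixP => k l; rewrite !mxE.
under eq_bigr do rewrite !mxE.
(* Reindexed over [S] itself, the sum retains at most the term [j = k]. *)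
rewrite -(big_enum_val (A := mem S) (fun j => (j == k)%:R * (j == l)%:R : R)) /=.
rewrite big_mkcond (bigD1 k) //= big1 ?addr0; last first.
  by move=> j /negPf ->; rewrite mul0r if_same.
by rewrite eqxx mul1r; case: (k \in S); rewrite ?mul0rn.
Qed.

Lemma diag_indU (R : realType) (n : nat) (S T : {set 'I_n}) :
  [disjoint S & T] -> diag_ind R (S :|: T) = diag_ind R S + diag_ind R T.
Proof.
move=> dST; rewrite -raddfD; congr diag_mx; apply/rowP => k; rewrite !mxE inE.
by case: (boolP (k \in S)) => [/(disjointFr dST) ->|_]; rewrite ?addr0 ?add0r.
Qed.

Lemma diag_indC (R : realType) (n : nat) (S : {set 'I_n}) :
  diag_ind R S + diag_ind R (~: S) = 1%:M.
Proof.
rewrite -diag_indU -?setI_eq0 ?setICr // setUCr -diag_const_mx.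
by congr diag_mx; apply/rowP => k; rewrite !mxE inE.
Qed.

Lemma disjoint_Gamma (R : realType) (m n : nat) (G : 'M[R]_(m, n))
    (om : {set 'I_n}) : [disjoint om & Gamma G om].
Proof.
by rewrite -setI_eq0; apply/eqP/setP => k; rewrite !inE; case: (k \in om).
Qed.

Definition agg_cols (R : realType) (m n : nat) (G : 'M[R]_(m, n))
    (om : {set 'I_n}) : 'M[R]_(#|nz G om|, #|om| + #|Gamma G om|) :=
  row_mx (setsub G (nz G om) om) (setsub G (nz G om) (Gamma G om)).

Lemma weighted_aggregateE (R : realType) (m n nc : nat) (G : 'M[R]_(m, n))
    (omega : 'I_nc -> {set 'I_n}) (i : 'I_nc) :
  let S := nz G (omega i) in
  weighted_aggregate G omega i =
    (agg_cols G (omega i))^T *m setsub (weight G omega) S S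
      *m agg_cols G (omega i).
Proof. by rewrite /= /agg_cols tr_row_mx mul_col_mx mul_col_row. Qed.

(** Split the identity on the right of [sel R (nz G om) *m G] into the projections onto [om],
    [Gamma G om] and [Delta G om]; the hypothesis kills the last, and the first two form the block
    product. *)
Lemma agg_cols_restriction (R : realType) (m n : nat) (G : 'M[R]_(m, n))
    (om : {set 'I_n}) :
  setsub G (nz G om) (Delta G om) = 0 ->
  agg_cols G om *m restriction G om = sel R (nz G om) *m G.
Proof.
move=> G0; rewrite -[RHS]mulmx1 -(diag_indC R (Omega G om)) mulmxDr.
have -> : sel R (nz G om) *m G *m diag_ind R (~: Omega G om) = 0.
  by rewrite -tr_sel_mul mulmxA -setsubE G0 mul0mx.
rewrite addr0 diag_indU ?disjoint_Gamma // mulmxDr -!tr_sel_mul !mulmxA.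
by rewrite -!setsubE mul_row_col.
Qed.

Lemma setsub_weight_diag (R : realType) (m n nc : nat) (G : 'M[R]_(m, n))
    (omega : 'I_nc -> {set 'I_n}) (S : {set 'I_m}) :
  setsub (weight G omega) S S =
    diag_mx (\row_a (multiplicity G omega (enum_val a))%:R^-1).
Proof.
by apply/matrixP => a b; rewrite !mxE (inj_eq enum_val_inj).
Qed.

Lemma multiplicity_gt0 (R : realType) (m n nc : nat) (G : 'M[R]_(m, n))
    (omega : 'I_nc -> {set 'I_n}) (j : 'I_m) :
  row j G != 0 -> \bigcup_(k < nc) omega k = [set: 'I_n] ->
  (0 < multiplicity G omega j)%N.
Proof.
move=> /rV0Pn [k]; rewrite mxE => Gjk cover_omega.
have /bigcupP [i _ ki] : k \in \bigcup_(i < nc) omega i by rewrite cover_omega inE.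
apply/card_gt0P; exists i; rewrite !inE.
by apply/existsP; exists k; rewrite ki.
Qed.

(** The weight stands between two projections because [setsubE] and [tr_sel_mul] produce this shape
    from [W(nz_i, nz_i)]. *)
Lemma sum_diag_weight (R : realType) (m n nc : nat) (G : 'M[R]_(m, n))
    (omega : 'I_nc -> {set 'I_n}) :
  (forall j, (0 < multiplicity G omega j)%N) ->
  \sum_(i < nc) diag_ind R (nz G (omega i)) *m weight G omega
                  *m diag_ind R (nz G (omega i)) = 1%:M.
Proof.
move=> M_gt0; under eq_bigr do rewrite !mulmx_diag.
rewrite -raddf_sum -diag_const_mx; congr diag_mx.
apply/rowP => j; rewrite summxE mxE.
(* The two equal indicators collapse to one; summed over [i], they count [M(j)]. *)
under eq_bigr => i _ do rewrite !mxE mulrAC -natrM mulnb andbb.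
rewrite -mulr_suml -natr_sum -big_mkcond sum1_card.
have -> : #|[pred i | j \in nz G (omega i)]| = multiplicity G omega j.
  by apply: eq_card => i; rewrite [in RHS]inE.
by rewrite divff // pnatr_eq0 -lt0n.
Qed.

(** With [y = B *m x], the quadratic form is the sum of the [d_a * y_a ^ 2]. *)
Lemma spsd_congruence_diag (R : realType) (p q : nat) (B : 'M[R]_(p, q))
    (d : 'rV[R]_p) :
  (forall a, 0 <= d 0 a) -> spsd (B^T *m diag_mx d *m B).
Proof.
move=> d_ge0; split.
  apply/is_hermitianmxP; rewrite expr0 scale1r map_mx_id //.
  by rewrite !trmx_mul tr_diag_mx trmxK mulmxA.
move=> x; rewrite !mulmxA -trmx_mul -!mulmxA mulmxA mul_mx_diag mxE.
rewrite sumr_ge0 // => a _.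
by rewrite 2!mxE mulrAC -expr2 mulr_ge0 ?sqr_ge0.
Qed.

Theorem lemma1 (R : realType) (m n nc : nat) (G : 'M[R]_(m, n))
    (omega : 'I_nc -> {set 'I_n})
    (G_no_zero_row : forall j : 'I_m, row j G != 0)
    (A_spd : spd (G^T *m G))
    (omega_partition : nonoverlapping_aggregates omega)
    (G_nz_Delta : forall i : 'I_nc,
       setsub G (nz G (omega i)) (Delta G (omega i)) = 0) :
  (forall i : 'I_nc, spsd (weighted_aggregate G omega i)) /\
  G^T *m G =
    \sum_(i < nc) (restriction G (omega i))^T
                  *m weighted_aggregate G omega i
                  *m restriction G (omega i).
Proof.
have [_ cover_omega] := omega_partition; split=> [i|].
  rewrite weighted_aggregateE setsub_weight_diag; apply: spsd_congruence_diag.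
  by move=> a; rewrite mxE invr_ge0 ler0n.
(* Inserting the identity between [G^T] and [G] as a sum over the aggregates lets the two sides be
   compared term by term. *)
rewrite -[G^T]mulmx1 -(@sum_diag_weight R m n nc G omega); last first.
  by move=> j; apply: multiplicity_gt0.
rewrite mulmx_sumr mulmx_suml; apply: eq_bigr => i _.
rewrite weighted_aggregateE !mulmxA -trmx_mul -!mulmxA agg_cols_restriction //.
by rewrite setsubE trmx_mul -!tr_sel_mul !mulmxA.
Qed.
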